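(* Let $f$ satisfy (f1) and suppose $f_0=0$ and $f_\infty=+\infty$. Then for every $\lambda\in(0,+\infty)$, problem (MO) has two solutions $u^+$ and $u^-$ such that $u^+$ is positive and strictly concave in $(0,1)$ and $u^-$ is negative and strictly convex in $(0,1)$.
   Context: Let $N\ge 1$ be an integer and $f:\mathbb{R}\to\mathbb{R}$ continuous. For $\lambda\ge 0$, problem (MO) is: find $u\in C^2[0,1]$ with $\left((u'(r))^N\right)'=\lambda^N N r^{N-1} f(-u(r))$ for $0<r<1$ and $u'(0)=u(1)=0$. Condition (f1): $f\in C(\mathbb{R},\mathbb{R})$ and $f(s)s^N>0$ for all $s\neq0$. The quantities $f_0,f_\infty\in[0,+\infty]$ are defined by $f_0^N=\lim_{s\to0} f(s)/s^N$ and $f_\infty^N=\lim_{|s|\to+\infty} f(s)/s^N$ (limits assumed to exist in $[0,+\infty]$). *)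

(* Defs.v *)
From Stdlib Require Import Reals Lra.
Open Scope R_scope.

Definition deriv_on01 (g g' : R -> R) : Prop :=
  forall x, 0 <= x <= 1 ->
  forall eps, 0 < eps -> exists delta, 0 < delta /\
    forall y, 0 <= y <= 1 -> y <> x -> Rabs (y - x) < delta ->
      Rabs ((g y - g x) / (y - x) - g' x) < eps.

Definition cont_on01 (g : R -> R) : Prop :=
  forall x, 0 <= x <= 1 ->
  forall eps, 0 < eps -> exists delta, 0 < delta /\
    forall y, 0 <= y <= 1 -> Rabs (y - x) < delta -> Rabs (g y - g x) < eps.

Definition MO_solution (N : nat) (f : R -> R) (lambda : R) (u : R -> R) : Prop :=
  exists u1 u2 : R -> R,
    deriv_on01 u u1 /\ deriv_on01 u1 u2 /\ cont_on01 u2 /\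
    (forall r, 0 < r < 1 ->
       derivable_pt_lim (fun t => (u1 t) ^ N) r
         (lambda ^ N * INR N * r ^ (N - 1) * f (- u r))) /\
    u1 0 = 0 /\ u 1 = 0.

Definition strictly_concave_01 (u : R -> R) : Prop :=
  forall x y t, 0 < x < 1 -> 0 < y < 1 -> x <> y -> 0 < t < 1 ->
    u (t * x + (1 - t) * y) > t * u x + (1 - t) * u y.

Definition strictly_convex_01 (u : R -> R) : Prop :=
  forall x y t, 0 < x < 1 -> 0 < y < 1 -> x <> y -> 0 < t < 1 ->
    u (t * x + (1 - t) * y) < t * u x + (1 - t) * u y.

Definition cond_f1 (N : nat) (f : R -> R) : Prop :=
  continuity f /\ forall s, s <> 0 -> f s * s ^ N > 0.

Definition f0_zero (N : nat) (f : R -> R) : Prop :=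
  forall eps, 0 < eps -> exists delta, 0 < delta /\
    forall s, s <> 0 -> Rabs s < delta -> Rabs (f s / s ^ N) < eps.

Definition finf_infty (N : nat) (f : R -> R) : Prop :=
  forall M, exists K, 0 < K /\
    forall s, K < Rabs s -> f s / s ^ N > M.

(* Main.v *)
Require Import Defs.
From Stdlib Require Import Reals ZArith Lra Lia Classical IndefiniteDescription.
From Coquelicot Require Import Coquelicot.
From mathcomp Require filter.
Open Scope R_scope.

(** Up to the sign change [u = - sg v] with [sg = 1] or [sg = -1], both solutions
    come from a positive concave [v] with [v' = - p], [p ^ N = P],
    [P' = (x ^ N)' g (v)], [P 0 = 0], [v 1 = 0], where [g >= 0] is continuous,
    [g (s) / s ^ N] tends to [0] at [0] and to infinity at infinity.

    Since [g] is only continuous, the initial value problem may lack uniqueness, so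
    the shooting is done on the explicit Euler scheme, whose value at [x = 1]
    depends continuously on the starting value [alpha].  It is positive for
    small [alpha] and nonpositive for large [alpha], uniformly in the step; the
    intermediate value theorem gives, for each step, a discrete solution
    vanishing at [1] whose starting value stays in a fixed [[a, b]], [a > 0].

    The discrete solutions are bounded and uniformly Lipschitz, so their pointwise
    limits along an ultrafilter exist, and the monotonicity of the scheme survives
    as the two-sided estimate [(y - x) p x <= v x - v y <= (y - x) p y], which
    yields differentiability and concavity.  Discrete concavity gives
    [v x >= a (1 - x)], so the limit is nontrivial. *)

(** * Limits along an ultrafilter on the naturals *)

(** The ultrafilter lemma of mathcomp, applied to the filter [eventually]. The result is repackaged
    as a Coquelicot [ProperFilter], so that it can be used with [filterlim]. *)
Lemma ultrafilter_on_nat :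
  exists U : (nat -> Prop) -> Prop,
    ProperFilter U /\
    (forall A, U A \/ U (fun n => ~ A n)) /\
    (forall A, eventually A -> U A).
Proof.
  destruct (@filter.ultraFilterLemma nat eventually) as [U [HU Hev]].
  - constructor.
    + intros [n Hn]; exact (Hn n (le_n n)).
    + constructor.
      * exists 0%nat; intros; exact I.
      * intros A B HA HB; exact (filter_and A B HA HB).
      * intros A B HAB HA; exact (filter_imp A B HAB HA).
  - pose proof (@filter.ultra_proper _ _ HU) as HP.
    pose proof (@filter.filter_filter _ _ HP) as HF.
    exists U; repeat split.
    + intros A HA; apply NNPP; intros Hex.
      apply (@filter.filter_not_empty _ _ HP).
      apply (@filter.filterS _ _ HF A); [|exact HA].
      intros n An; apply Hex; now exists n.
    + exact (@filter.filterT _ _ HF).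
    + intros A B HA HB; exact (@filter.filterI _ _ HF A B HA HB).
    + intros A B HAB HA; exact (@filter.filterS _ _ HF A B HAB HA).
    + intros A; exact (@filter.in_ultra_setVsetC _ _ A HU).
    + exact Hev.
Qed.

(** The limit is the supremum of those [x] that lie below [u n] for [U]-many [n]. The dichotomy for
    [U] then puts [U]-many terms below [l + eps] and [U]-many above [l - eps]. *)
Lemma ultrafilter_bounded_lim (U : (nat -> Prop) -> Prop) (u : nat -> R) (a b : R) :
  ProperFilter U -> (forall A, U A \/ U (fun n => ~ A n)) ->
  (forall n, a <= u n <= b) ->
  exists l, filterlim u U (locally l).
Proof.
  intros HP HU Hu.
  destruct (completeness (fun x => U (fun n => x <= u n))) as [l [Hub Hlub]].
  - exists b; intros x Hx.
    destruct (filter_ex _ Hx) as [n Hn]; specialize (Hu n); lra.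
  - exists a; apply filter_imp with (fun _ => True); [|apply filter_true].
    intros n _; apply Hu.
  - exists l; apply filterlim_locally; intros eps.
    assert (H1 : U (fun n => u n < l + eps)).
    { destruct (HU (fun n => l + eps <= u n)) as [H|H].
      - specialize (Hub _ H); destruct eps; simpl in *; lra.
      - revert H; apply filter_imp; intros n; lra. }
    assert (H2 : U (fun n => l - eps < u n)).
    { destruct (HU (fun n => l - eps < u n)) as [H|H]; [exact H|].
      assert (l <= l - eps); [|destruct eps; simpl in *; lra].
      apply Hlub; intros x Hx; apply Rnot_lt_le; intros Hlt.
      destruct (filter_ex _ (filter_and _ _ Hx H)) as [n [Hn Hn']]; lra. }
    generalize (filter_and _ _ H1 H2); apply filter_imp; intros n [Hn Hn'].
    apply Rabs_def1; unfold minus, plus, opp; simpl; lra.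
Qed.

(** * The [N]-th root *)

(* Extended by [0] to the negative half-line, where it is still continuous. *)
Definition root (N : nat) (x : R) : R :=
  if Rle_dec x 0 then 0 else Rpower x (/ INR N).

Lemma root_ge_0 (N : nat) (x : R) : 0 <= root N x.
Proof.
  unfold root; destruct (Rle_dec x 0); [lra|].
  left; apply exp_pos.
Qed.

Lemma root_npos (N : nat) (x : R) : x <= 0 -> root N x = 0.
Proof. unfold root; destruct (Rle_dec x 0); lra. Qed.

Lemma root_pow (N : nat) (x : R) : (1 <= N)%nat -> 0 <= x -> root N x ^ N = x.
Proof.
  intros HN Hx; unfold root; destruct (Rle_dec x 0).
  - rewrite pow_i by lia; lra.
  - rewrite <- Rpower_pow by apply exp_pos.
    rewrite Rpower_mult, Rinv_l, Rpower_1; [reflexivity|lra|].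
    apply not_0_INR; lia.
Qed.

Lemma pow_lt_compat_l (N : nat) (x y : R) :
  (1 <= N)%nat -> 0 <= x < y -> x ^ N < y ^ N.
Proof.
  intros HN H; induction N as [|[|N] IH]; [lia|simpl; lra|].
  change (x * x ^ S N < y * y ^ S N).
  apply Rmult_le_0_lt_compat; [lra|apply pow_le; lra|lra|apply IH; lia].
Qed.

Lemma pow_le_reg_l (N : nat) (x y : R) :
  (1 <= N)%nat -> 0 <= y -> x ^ N <= y ^ N -> x <= y.
Proof.
  intros HN Hy H; apply Rnot_lt_le; intros Hlt.
  pose proof (pow_lt_compat_l N y x HN); lra.
Qed.

Lemma pow_root (N : nat) (x : R) : (1 <= N)%nat -> 0 <= x -> root N (x ^ N) = x.
Proof.
  intros HN Hx.
  pose proof (root_ge_0 N (x ^ N)) as H0.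
  pose proof (root_pow N (x ^ N) HN (pow_le x N Hx)) as H.
  apply Rle_antisym; apply (pow_le_reg_l N); auto; lra.
Qed.

Lemma root_le_compat (N : nat) (x y : R) :
  (1 <= N)%nat -> x <= y -> root N x <= root N y.
Proof.
  intros HN H; destruct (Rle_dec x 0) as [Hx|Hx].
  - rewrite root_npos by exact Hx; apply root_ge_0.
  - apply (pow_le_reg_l N); [exact HN|apply root_ge_0|].
    rewrite !root_pow; auto; lra.
Qed.

Lemma root_lt_compat (N : nat) (x y : R) :
  (1 <= N)%nat -> 0 <= x < y -> root N x < root N y.
Proof.
  intros HN H; apply Rnot_le_lt; intros Hle.
  assert (root N y ^ N <= root N x ^ N)
    by (apply pow_incr; split; [apply root_ge_0|exact Hle]).
  rewrite !root_pow in H0; auto; lra.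
Qed.

Lemma root_div_pow (N : nat) (x y : R) :
  (1 <= N)%nat -> 0 <= x -> 0 < y -> root N (x / y ^ N) = root N x / y.
Proof.
  intros HN Hx Hy.
  replace (x / y ^ N) with ((root N x / y) ^ N).
  - apply pow_root; [exact HN|]; apply Rdiv_le_0_compat; [apply root_ge_0|lra].
  - unfold Rdiv; rewrite Rpow_mult_distr, root_pow, pow_inv; auto.
Qed.

Lemma is_derive_root (N : nat) (x : R) :
  0 < x -> is_derive (root N) x (root N x / (INR N * x)).
Proof.
  intros Hx.
  apply is_derive_ext_loc with (fun y => exp (/ INR N * ln y)).
  - exists (mkposreal x Hx); intros y Hy.
    unfold root; destruct (Rle_dec y 0) as [H|H]; [|reflexivity].
    apply Rabs_def2 in Hy; unfold minus, plus, opp in Hy; simpl in Hy; lra.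
  - replace (root N x) with (exp (/ INR N * ln x)).
    + auto_derive; [exact Hx|]; unfold Rdiv; rewrite Rinv_mult; ring.
    + unfold root; destruct (Rle_dec x 0); [lra|reflexivity].
Qed.

Lemma continuous_root (N : nat) (x : R) : (1 <= N)%nat -> continuous (root N) x.
Proof.
  intros HN; destruct (Rlt_dec 0 x) as [Hx|Hx].
  - apply (@ex_derive_continuous R_AbsRing R_NormedModule).
    eexists; apply is_derive_root, Hx.
  - apply filterlim_locally; intros eps.
    (* For [x <= 0] the radius [eps ^ N] works: [root N y >= eps] would force [y >= eps ^ N]. *)
    assert (He : 0 < eps ^ N) by (apply pow_lt, cond_pos).
    exists (mkposreal _ He); intros y Hy.
    apply Rabs_def2 in Hy; unfold minus, plus, opp in Hy; simpl in Hy.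
    rewrite (root_npos N x) by lra.
    pose proof (root_ge_0 N y).
    assert (root N y < eps).
    { apply Rnot_le_lt; intros Hle.
      assert (eps ^ N <= y); [|lra].
      destruct (Rle_dec y 0).
      - rewrite root_npos in Hle by auto; destruct eps; simpl in *; lra.
      - rewrite <- (root_pow N y) by (auto; lra).
        apply pow_incr; destruct eps; simpl in *; lra. }
    apply Rabs_def1; unfold minus, plus, opp; simpl; lra.
Qed.

(** * Arithmetic and order of real limits along a filter *)

Lemma filterlim_Rminus {T} (F : (T -> Prop) -> Prop) {FF : Filter F}
    (u w : T -> R) (l k : R) :
  filterlim u F (locally l) -> filterlim w F (locally k) ->
  filterlim (fun n => u n - w n) F (locally (l - k)).
Proof.
  intros Hu Hw.
  apply (filterlim_comp_2 (G := locally l) (H := locally (- k))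
    u (fun n => - w n) Rplus Hu).
  - exact (filterlim_comp _ _ _ w Ropp F _ _ Hw (filterlim_opp (V := R_NormedModule) k)).
  - apply (filterlim_plus (V := R_NormedModule)).
Qed.

Lemma filterlim_Rmult {T} (F : (T -> Prop) -> Prop) {FF : Filter F}
    (u w : T -> R) (l k : R) :
  filterlim u F (locally l) -> filterlim w F (locally k) ->
  filterlim (fun n => u n * w n) F (locally (l * k)).
Proof.
  intros Hu Hw.
  apply (filterlim_comp_2 (G := locally l) (H := locally k) u w Rmult Hu Hw).
  apply (filterlim_mult (K := R_AbsRing)).
Qed.

Lemma filterlim_continuous {T} (F : (T -> Prop) -> Prop) {FF : Filter F}
    (f : R -> R) (u : T -> R) (l : R) :
  continuous f l -> filterlim u F (locally l) ->
  filterlim (fun n => f (u n)) F (locally (f l)).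
Proof. intros Hf Hu; exact (filterlim_comp _ _ _ u f F _ _ Hu Hf). Qed.

Lemma filterlim_Rle {T} (F : (T -> Prop) -> Prop) {FF : ProperFilter F}
    (u w : T -> R) (l k : R) :
  F (fun n => u n <= w n) ->
  filterlim u F (locally l) -> filterlim w F (locally k) -> l <= k.
Proof. intros H Hu Hw; exact (filterlim_le u w (Finite l) (Finite k) H Hu Hw). Qed.

Lemma continuous_pow (N : nat) (x : R) : continuous (fun y => y ^ N) x.
Proof.
  apply (@ex_derive_continuous R_AbsRing R_NormedModule); auto_derive; auto.
Qed.

(** * Index of the grid point to the left of a real number *)

(* For [x < 0] the truncation in [Z.to_nat] makes this [0]. *)
Definition cell (h x : R) : nat := Z.to_nat (Int_part (x / h)).

Lemma cell_spec (h x : R) :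
  0 < h -> Rmax x 0 - h < INR (cell h x) * h <= Rmax x 0.
Proof.
  intros Hh; unfold cell.
  destruct (base_Int_part (x / h)) as [H1 H2].
  set (z := Int_part (x / h)) in *.
  assert (Hx : x = x / h * h) by (field; lra).
  set (q := x / h) in *.
  destruct (Z_le_gt_dec 0 z) as [Hz|Hz].
  - rewrite INR_IZR_INZ, Z2Nat.id by exact Hz.
    apply IZR_le in Hz.
    rewrite Rmax_left by nra; nra.
  - replace (Z.to_nat z) with 0%nat by lia.
    assert (IZR z <= -1) by (apply IZR_le; lia).
    rewrite Rmax_right by nra; simpl; nra.
Qed.

Lemma cell_le (h x y : R) : 0 < h -> x <= y -> (cell h x <= cell h y)%nat.
Proof.
  intros Hh Hxy.
  destruct (cell_spec h x Hh) as [_ H1]; destruct (cell_spec h y Hh) as [H2 _].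
  assert (Rmax x 0 <= Rmax y 0) by (apply Rle_max_compat_r, Hxy).
  assert (H3 : INR (cell h x) < INR (S (cell h y)))
    by (rewrite S_INR; apply Rmult_lt_reg_r with h; lra).
  apply INR_lt in H3; lia.
Qed.

Lemma cell_npos (h x : R) : 0 < h -> x <= 0 -> cell h x = 0%nat.
Proof.
  intros Hh Hx; destruct (cell_spec h x Hh) as [_ H].
  rewrite Rmax_right in H by exact Hx.
  destruct (cell h x) as [|k]; [reflexivity|].
  pose proof (lt_0_INR (S k) ltac:(lia)); nra.
Qed.

Lemma cell_grid (h : R) (n : nat) : 0 < h -> cell h (INR n * h) = n.
Proof.
  intros Hh; destruct (cell_spec h (INR n * h) Hh) as [H1 H2].
  rewrite Rmax_left in H1, H2 by (apply Rmult_le_pos; [apply pos_INR|lra]).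
  apply Rmult_le_reg_r in H2; [|exact Hh]; apply INR_le in H2.
  assert (H3 : INR n < INR (S (cell h (INR n * h))))
    by (rewrite S_INR; apply Rmult_lt_reg_r with h; lra).
  apply INR_lt in H3; lia.
Qed.

(** * The Euler scheme and its discrete estimates *)

Section Shooting.

Context (N : nat) (g : R -> R).
Context (N_ge_1 : (1 <= N)%nat).
Context (g_cont : forall s, continuous g s).
(** With [g] zero on the negative half-line, the scheme can be continued after [v] has changed sign,
    and [S] is constant from then on. *)
Context (g_npos : forall s, s <= 0 -> g s = 0).
Context (g_pos : forall s, 0 < s -> 0 < g s).
Context (g_sublinear : forall eps, 0 < eps -> exists delta, 0 < delta /\
  forall s, 0 < s < delta -> g s <= eps * s ^ N).
Context (g_superlinear : forall M, exists K, 0 < K /\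
  forall s, K < s -> M * s ^ N <= g s).

(* Explicit Euler scheme of step [h] for [v' = - root N S], [S' = (x ^ N)' g (v)],
   started at [v = alpha], [S = 0]. *)
Fixpoint euler (h alpha : R) (k : nat) : R * R :=
  match k with
  | O => (alpha, 0)
  | S k' =>
      let (v, s) := euler h alpha k' in
      (v - h * root N s,
       s + ((INR (S k') * h) ^ N - (INR k' * h) ^ N) * g v)
  end.

Definition euler_v (h alpha : R) (k : nat) : R := fst (euler h alpha k).
Definition euler_s (h alpha : R) (k : nat) : R := snd (euler h alpha k).

Lemma euler_v_S (h alpha : R) (k : nat) :
  euler_v h alpha (S k) = euler_v h alpha k - h * root N (euler_s h alpha k).
Proof.
  unfold euler_v, euler_s; simpl; now destruct (euler h alpha k).
Qed.

Lemma euler_s_S (h alpha : R) (k : nat) :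
  euler_s h alpha (S k) = euler_s h alpha k
    + ((INR (S k) * h) ^ N - (INR k * h) ^ N) * g (euler_v h alpha k).
Proof.
  unfold euler_v, euler_s; simpl euler; now destruct (euler h alpha k).
Qed.

Lemma g_ge_0 (s : R) : 0 <= g s.
Proof.
  destruct (Rle_dec s 0) as [H|H].
  - rewrite g_npos; lra.
  - left; apply g_pos; lra.
Qed.

Lemma g_bounded_above (b : R) : exists G, 0 < G /\ forall s, s <= b -> g s <= G.
Proof.
  destruct (continuity_ab_maj g 0 (Rmax b 0)) as [M [HM _]].
  - apply Rmax_r.
  - intros c _; apply continuity_pt_filterlim, g_cont.
  - exists (g M + 1); split; [pose proof (g_ge_0 M); lra|].
    intros s Hs; destruct (Rle_dec s 0) as [H|H].
    + rewrite g_npos by exact H; pose proof (g_ge_0 M); lra.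
    + assert (g s <= g M); [|lra].
      apply HM; pose proof (Rmax_l b 0); lra.
Qed.

Lemma grid_pow_le (h : R) (i j : nat) :
  0 < h -> (i <= j)%nat -> (INR i * h) ^ N <= (INR j * h) ^ N.
Proof.
  intros Hh Hij; apply le_INR in Hij; apply pow_incr; split.
  - apply Rmult_le_pos; [apply pos_INR|lra].
  - apply Rmult_le_compat_r; lra.
Qed.

(** The scheme weights [g] by exact differences of [x ^ N], which telescope. Bounds on [g] therefore
    pass to the discrete integral with no discretization error. *)
Lemma euler_s_increment (h alpha c d : R) (i j : nat) :
  0 < h -> (i <= j)%nat ->
  (forall k, (i <= k < j)%nat -> c <= g (euler_v h alpha k) <= d) ->
  ((INR j * h) ^ N - (INR i * h) ^ N) * c
    <= euler_s h alpha j - euler_s h alpha i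
    <= ((INR j * h) ^ N - (INR i * h) ^ N) * d.
Proof.
  intros Hh Hij; induction Hij as [|j Hij IH]; intros Hcd; [lra|].
  assert (Hj : c <= g (euler_v h alpha j) <= d) by (apply Hcd; lia).
  assert (IH' := IH (fun k Hk => Hcd k (conj (proj1 Hk) (le_S _ _ (proj2 Hk))))).
  rewrite euler_s_S.
  pose proof (grid_pow_le h j (S j) Hh (le_S _ _ (le_n j))) as Hp.
  split; nra.
Qed.

Lemma euler_s_le (h alpha : R) (i j : nat) :
  0 < h -> (i <= j)%nat -> euler_s h alpha i <= euler_s h alpha j.
Proof.
  intros Hh Hij; induction Hij as [|j Hij IH]; [lra|].
  rewrite euler_s_S.
  pose proof (grid_pow_le h j (S j) Hh (le_S _ _ (le_n j))) as Hp.
  pose proof (g_ge_0 (euler_v h alpha j)).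
  nra.
Qed.

Lemma euler_s_ge_0 (h alpha : R) (k : nat) : 0 < h -> 0 <= euler_s h alpha k.
Proof. intros Hh; apply (euler_s_le h alpha 0 k Hh); lia. Qed.

(** Since [euler_s] is nondecreasing in the index, every slope used between [i] and [j] lies between
    the roots of its two end values. *)
Lemma euler_v_increment (h alpha : R) (i j : nat) :
  0 < h -> (i <= j)%nat ->
  (INR j * h - INR i * h) * root N (euler_s h alpha i)
    <= euler_v h alpha i - euler_v h alpha j
    <= (INR j * h - INR i * h) * root N (euler_s h alpha j).
Proof.
  intros Hh Hij; induction Hij as [|j Hij IH]; [lra|].
  rewrite euler_v_S, S_INR.
  pose proof (root_le_compat N _ _ N_ge_1 (euler_s_le h alpha i j Hh Hij)).
  pose proof (root_le_compat N _ _ N_ge_1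
    (euler_s_le h alpha j (S j) Hh (le_S _ _ (le_n j)))).
  apply le_INR in Hij.
  split; [nra|].
  assert ((INR j * h - INR i * h) * root N (euler_s h alpha j)
    <= (INR j * h - INR i * h) * root N (euler_s h alpha (S j)));
    [apply Rmult_le_compat_l; nra | nra].
Qed.

Lemma euler_v_antitone (h alpha : R) (i j : nat) :
  0 < h -> (i <= j)%nat -> euler_v h alpha j <= euler_v h alpha i.
Proof.
  intros Hh Hij; pose proof (euler_v_increment h alpha i j Hh Hij) as [H _].
  apply le_INR in Hij; pose proof (root_ge_0 N (euler_s h alpha i)).
  assert (0 <= (INR j * h - INR i * h) * root N (euler_s h alpha i))
    by (apply Rmult_le_pos; nra).
  lra.
Qed.

Lemma euler_s_bound (h alpha G : R) (k : nat) :
  0 < h -> (forall s, s <= alpha -> g s <= G) ->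
  euler_s h alpha k <= (INR k * h) ^ N * G.
Proof.
  intros Hh HG.
  destruct (euler_s_increment h alpha 0 G 0 k Hh) as [_ H]; [lia| |].
  - intros i _; split; [apply g_ge_0|].
    apply HG; apply (euler_v_antitone h alpha 0 i Hh); lia.
  - change (euler_s h alpha 0) with 0 in H.
    change (INR 0) with 0 in H; rewrite Rmult_0_l, pow_i in H by lia; lra.
Qed.

(* Discrete concavity: the chord from [(0, alpha)] lies below the polygon. *)
Lemma euler_v_chord (h alpha : R) (k n : nat) :
  0 < h -> (k <= n)%nat -> INR n * h = 1 ->
  alpha * (1 - INR k * h) + INR k * h * euler_v h alpha n <= euler_v h alpha k.
Proof.
  intros Hh Hkn Hn.
  destruct (euler_v_increment h alpha 0 k Hh) as [_ H1]; [lia|].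
  destruct (euler_v_increment h alpha k n Hh Hkn) as [H2 _].
  change (euler_v h alpha 0) with alpha in H1; change (INR 0) with 0 in H1.
  rewrite Hn in H2.
  assert (0 <= INR k * h) by (apply Rmult_le_pos; [apply pos_INR|lra]).
  apply le_INR in Hkn.
  assert (INR k * h <= 1) by (rewrite <- Hn; apply Rmult_le_compat_r; lra).
  set (x := INR k * h) in *; set (p := root N _) in *.
  assert ((alpha - euler_v h alpha k) * (1 - x) <= x * p * (1 - x))
    by (apply Rmult_le_compat_r; lra).
  assert (x * ((1 - x) * p) <= x * (euler_v h alpha k - euler_v h alpha n))
    by (apply Rmult_le_compat_l; lra).
  nra.
Qed.

Lemma continuous_euler (h : R) (k : nat) (alpha : R) :
  continuous (fun a => euler_v h a k) alpha /\
  continuous (fun a => euler_s h a k) alpha.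
Proof.
  induction k as [|k [IHv IHs]]; split.
  - apply continuous_id.
  - apply continuous_const.
  - apply continuous_ext with
      (fun a => minus (euler_v h a k) (mult h (root N (euler_s h a k)))).
    { intros a; symmetry; apply euler_v_S. }
    apply (continuous_minus (V := R_NormedModule)); [exact IHv|].
    apply (continuous_mult (K := R_AbsRing)); [apply continuous_const|].
    apply (continuous_comp _ (root N)); [exact IHs|].
    apply continuous_root, N_ge_1.
  - apply continuous_ext with
      (fun a => plus (euler_s h a k)
         (mult ((INR (S k) * h) ^ N - (INR k * h) ^ N) (g (euler_v h a k)))).
    { intros a; symmetry; apply euler_s_S. }
    apply (continuous_plus (V := R_NormedModule)); [exact IHs|].
    apply (continuous_mult (K := R_AbsRing)); [apply continuous_const|].
    apply (continuous_comp _ g); [exact IHv|apply g_cont].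
Qed.

(** * Shooting on the starting value *)

(** If [g s <= (s / 2) ^ N] for [0 < s <= a], then [S <= (a / 2) ^ N] at [x = 1]. All slopes are
    then at most [a / 2], so [v] loses at most half of its starting value. *)
Lemma euler_small_start : exists a, 0 < a /\
  forall h n, 0 < h -> INR n * h = 1 -> 0 < euler_v h a n.
Proof.
  destruct (g_sublinear ((/ 2) ^ N)) as [delta [Hd H]]; [apply pow_lt; lra|].
  exists (delta / 2); split; [lra|]; intros h n Hh Hn.
  set (a := delta / 2) in *.
  assert (Hs : euler_s h a n <= (a / 2) ^ N).
  { rewrite <- (Rmult_1_l ((a / 2) ^ N)), <- (pow1 N), <- Hn.
    apply euler_s_bound; [exact Hh|]; intros s Hs.
    destruct (Rle_dec s 0) as [Hs0|Hs0].
    - rewrite g_npos by exact Hs0; apply pow_le; unfold a; lra.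
    - apply Rle_trans with ((/ 2) ^ N * s ^ N); [apply H; unfold a in *; lra|].
      rewrite <- Rpow_mult_distr; apply pow_incr; lra. }
  apply (root_le_compat N) in Hs; [|exact N_ge_1].
  rewrite pow_root in Hs by (try exact N_ge_1; unfold a; lra).
  destruct (euler_v_increment h a 0 n Hh) as [_ H1]; [lia|].
  change (euler_v h a 0) with a in H1; change (INR 0) with 0 in H1.
  rewrite Hn in H1; unfold a in *; lra.
Qed.

(** Suppose [v] is still positive at [1]. The chord estimate gives [v >= b / 2 > K] on the first
    half, so [g (v) >= (8 b) ^ N] there and [S >= (4 b) ^ N] at [x = 1 / 2]. On the second half [v]
    then drops by at least [2 b], although it starts there from at most [b]. The number of steps is
    even so that [1 / 2] is a grid point. *)
Lemma euler_large_start (a : R) : exists b, a < b /\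
  forall h m, 0 < h -> INR (2 * m) * h = 1 -> euler_v h b (2 * m) <= 0.
Proof.
  destruct (g_superlinear (16 ^ N)) as [K [HK H]].
  set (b := Rmax (2 * K) a + 1).
  assert (HbK : 2 * K < b) by (pose proof (Rmax_l (2 * K) a); unfold b; lra).
  exists b; split; [pose proof (Rmax_r (2 * K) a); unfold b; lra|].
  intros h m Hh Hn; apply Rnot_lt_le; intros Hv.
  assert (Hm : INR m * h = / 2)
    by (rewrite mult_INR in Hn; simpl (INR 2) in Hn; lra).
  assert (Hs : (4 * b) ^ N <= euler_s h b m).
  { destruct (g_bounded_above b) as [G [_ HG]].
    destruct (euler_s_increment h b ((16 * (b / 2)) ^ N) G 0 m Hh) as [Hs _]; [lia| |].
    - intros k Hk; split.
      2: { apply HG; apply (euler_v_antitone h b 0 k Hh); lia. }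
      assert (Hc := euler_v_chord h b k (2 * m) Hh ltac:(lia) Hn).
      assert (HkI : INR k <= INR m) by (apply le_INR; lia).
      assert (INR k * h <= / 2) by (rewrite <- Hm; apply Rmult_le_compat_r; lra).
      assert (0 <= INR k * h) by (apply Rmult_le_pos; [apply pos_INR|lra]).
      assert (Hvk : b / 2 <= euler_v h b k) by nra.
      apply Rle_trans with (16 ^ N * euler_v h b k ^ N).
      + rewrite <- Rpow_mult_distr; apply pow_incr; lra.
      + apply H; lra.
    - change (euler_s h b 0) with 0 in Hs; change (INR 0) with 0 in Hs.
      rewrite Rmult_0_l, pow_i, Hm, !Rminus_0_r in Hs by lia.
      rewrite <- Rpow_mult_distr in Hs.
      replace (4 * b) with (/ 2 * (16 * (b / 2))) by field; exact Hs. }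
  apply (root_le_compat N) in Hs; [|exact N_ge_1].
  rewrite pow_root in Hs by (try exact N_ge_1; lra).
  destruct (euler_v_increment h b m (2 * m) Hh) as [H1 _]; [lia|].
  rewrite Hn, Hm in H1.
  assert (euler_v h b m <= b) by (apply (euler_v_antitone h b 0 m Hh); lia).
  nra.
Qed.

(** The number of cells is even, as [euler_large_start] demands, and [S m] keeps it nonzero. *)
Definition step (m : nat) : R := / INR (2 * S m).

Lemma INR_step (m : nat) : INR (2 * S m) * step m = 1.
Proof. apply Rinv_r, not_0_INR; lia. Qed.

Lemma step_pos (m : nat) : 0 < step m.
Proof. apply Rinv_0_lt_compat, lt_0_INR; lia. Qed.

Lemma euler_shooting : exists a b, 0 < a /\
  forall m, exists alpha, a <= alpha <= b /\
    euler_v (step m) alpha (2 * S m) = 0.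
Proof.
  destruct euler_small_start as [a [Ha Hsmall]].
  destruct (euler_large_start a) as [b [Hab Hlarge]].
  exists a, b; split; [exact Ha|]; intros m.
  specialize (Hsmall (step m) (2 * S m)%nat (step_pos m) (INR_step m)).
  specialize (Hlarge (step m) (S m) (step_pos m) (INR_step m)).
  destruct (IVT_gen (fun x => euler_v (step m) x (2 * S m)) a b 0)
    as [alpha [H1 H2]].
  - intros x; apply continuity_pt_filterlim, continuous_euler.
  - rewrite Rmin_right, Rmax_left; lra.
  - rewrite Rmin_left, Rmax_right in H1 by lra.
    now exists alpha.
Qed.

(** * Passage to the limit as the step tends to zero *)

Lemma step_lt_eventually (eps : R) : 0 < eps -> eventually (fun m => step m < eps).
Proof.
  intros He; destruct (archimed_cor1 eps He) as [n [Hn Hn0]].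
  exists n; intros m Hm; unfold step.
  apply Rle_lt_trans with (/ INR n); [|exact Hn].
  apply Rinv_le_contravar; [apply lt_0_INR; lia|apply le_INR; lia].
Qed.

Lemma filterlim_cell (x : R) :
  filterlim (fun m => INR (cell (step m) x) * step m) eventually (locally (Rmax x 0)).
Proof.
  apply filterlim_locally; intros eps.
  generalize (step_lt_eventually eps (cond_pos eps)); apply filter_imp; intros m Hm.
  destruct (cell_spec (step m) x (step_pos m)).
  apply Rabs_def1; unfold minus, plus, opp; simpl; lra.
Qed.

(** Form of [euler_s_increment] for indices in either order. The error is relative to the variation
    of [x ^ N], so in the limit it identifies the derivative of [P] with respect to [x ^ N]. *)
Lemma euler_s_approx (h alpha c eps : R) (i j : nat) :
  0 < h ->
  (forall k, (Nat.min i j <= k <= Nat.max i j)%nat ->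
     Rabs (g (euler_v h alpha k) - c) <= eps) ->
  Rabs (euler_s h alpha j - euler_s h alpha i
        - ((INR j * h) ^ N - (INR i * h) ^ N) * c)
    <= eps * Rabs ((INR j * h) ^ N - (INR i * h) ^ N).
Proof.
  intros Hh H.
  assert (H' : forall k, (Nat.min i j <= k <= Nat.max i j)%nat ->
    c - eps <= g (euler_v h alpha k) <= c + eps).
  { intros k Hk; specialize (H k Hk); apply Rabs_le_between in H; lra. }
  destruct (le_lt_dec i j) as [Hij|Hij].
  - pose proof (grid_pow_le h i j Hh Hij) as Hp.
    rewrite (Rabs_pos_eq (_ - _ ^ N)) by lra.
    destruct (euler_s_increment h alpha (c - eps) (c + eps) i j Hh Hij).
    + intros k Hk; apply H'; lia.
    + apply Rabs_le; nra.
  - assert (Hji : (j <= i)%nat) by lia.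
    pose proof (grid_pow_le h j i Hh Hji) as Hp.
    rewrite (Rabs_left1 (_ - _ ^ N)) by lra.
    destruct (euler_s_increment h alpha (c - eps) (c + eps) j i Hh Hji).
    + intros k Hk; apply H'; lia.
    + apply Rabs_le; nra.
Qed.

Lemma euler_v_lipschitz (h alpha C : R) (i k n : nat) :
  0 < h -> (i <= n)%nat -> (k <= n)%nat -> root N (euler_s h alpha n) <= C ->
  Rabs (euler_v h alpha k - euler_v h alpha i) <= C * Rabs (INR k * h - INR i * h).
Proof.
  assert (Hlt : forall i k, 0 < h -> (i <= k)%nat -> (k <= n)%nat ->
    root N (euler_s h alpha n) <= C ->
    Rabs (euler_v h alpha k - euler_v h alpha i) <= C * Rabs (INR k * h - INR i * h)).
  { clear i k; intros i k Hh Hik Hkn HC.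
    destruct (euler_v_increment h alpha i k Hh Hik) as [_ H].
    pose proof (euler_v_antitone h alpha i k Hh Hik).
    pose proof (root_le_compat N _ _ N_ge_1 (euler_s_le h alpha k n Hh Hkn)).
    apply le_INR in Hik.
    rewrite Rabs_left1, Rabs_pos_eq by nra.
    assert ((INR k * h - INR i * h) * root N (euler_s h alpha k)
      <= (INR k * h - INR i * h) * C) by (apply Rmult_le_compat_l; nra).
    lra. }
  intros Hh Hi Hk HC; destruct (le_lt_dec i k) as [Hik|Hik]; [now apply Hlt|].
  rewrite Rabs_minus_sym, (Rabs_minus_sym (INR k * h)); apply Hlt; auto; lia.
Qed.

(** The limits are taken on the whole line, which makes two-sided derivatives available at [0] and
    [1]. The clause with [eps] says that [P] has derivative [g (v x)] with respect to [x ^ N].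
    Stating it with increments keeps the information at [x = 0], where the derivative of [x ^ N] may
    vanish. *)
Lemma euler_limit : exists (a : R) (v P : R -> R),
  0 < a /\
  (forall x y, x <= y ->
     (y - x) * root N (P x) <= v x - v y <= (y - x) * root N (P y)) /\
  (forall x eps, 0 < eps -> exists delta, 0 < delta /\
     forall y, Rabs (y - x) < delta ->
       Rabs (P y - P x - (Rmax y 0 ^ N - Rmax x 0 ^ N) * g (v x))
         <= eps * Rabs (Rmax y 0 ^ N - Rmax x 0 ^ N)) /\
  (forall x, 0 <= P x) /\ (forall x, x <= 0 -> P x = 0) /\
  v 1 = 0 /\ (forall x, 0 <= x <= 1 -> a * (1 - x) <= v x).
Proof.
  destruct ultrafilter_on_nat as [U [HP [HU Hev]]].
  destruct euler_shooting as [a [b [Ha Hshoot]]].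
  apply functional_choice in Hshoot; destruct Hshoot as [alpha Halpha].
  destruct (g_bounded_above b) as [G [HG0 HG]].
  (* For fixed [x], the sequences of values of [v], of [S] and of the abscissa at the grid point
     left of [x]. *)
  set (V := fun x m => euler_v (step m) (alpha m) (cell (step m) x)).
  set (W := fun x m => euler_s (step m) (alpha m) (cell (step m) x)).
  set (X := fun x m => INR (cell (step m) x) * step m).
  assert (HW : forall x m, 0 <= W x m <= Rmax x 0 ^ N * G).
  { intros x m; split; [apply euler_s_ge_0, step_pos|].
    apply Rle_trans with (X x m ^ N * G).
    - apply euler_s_bound; [apply step_pos|].
      intros s Hs; apply HG; destruct (Halpha m); lra.
    - apply Rmult_le_compat_r; [lra|]; apply pow_incr; split.
      + apply Rmult_le_pos; [apply pos_INR|left; apply step_pos].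
      + apply cell_spec, step_pos. }
  assert (HlimW : forall x, exists l, filterlim (W x) U (locally l)).
  { intros x; exact (ultrafilter_bounded_lim U (W x) _ _ HP HU (HW x)). }
  assert (HlimV : forall x, exists l, filterlim (V x) U (locally l)).
  { intros x.
    apply (ultrafilter_bounded_lim U (V x)
      (a - Rmax x 0 * root N (Rmax x 0 ^ N * G)) b HP HU); intros m.
    destruct (Halpha m) as [[H1 H2] _]; split.
    - destruct (euler_v_increment (step m) (alpha m) 0 (cell (step m) x) (step_pos m))
        as [_ H]; [lia|].
      change (euler_v (step m) (alpha m) 0) with (alpha m) in H.
      change (INR 0) with 0 in H.
      assert (X x m * root N (W x m) <= Rmax x 0 * root N (Rmax x 0 ^ N * G)).
      { apply Rmult_le_compat; [|apply root_ge_0|apply cell_spec, step_pos|].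
        - apply Rmult_le_pos; [apply pos_INR|left; apply step_pos].
        - apply root_le_compat; [exact N_ge_1|apply HW]. }
      unfold X, V, W in *; lra.
    - apply Rle_trans with (alpha m); [|exact H2].
      apply (euler_v_antitone (step m) (alpha m) 0); [apply step_pos|lia]. }
  apply functional_choice in HlimW; destruct HlimW as [P HlimW].
  apply functional_choice in HlimV; destruct HlimV as [v HlimV].
  assert (HlimX : forall x, filterlim (X x) U (locally (Rmax x 0))).
  { intros x A HA; apply Hev; exact (filterlim_cell x A HA). }
  assert (Hall : forall A : nat -> Prop, (forall m, A m) -> U A)
    by (intros A HA; apply filter_imp with (2 := filter_true); auto).
  assert (P_ge_0 : forall x, 0 <= P x).
  { intros x; apply (filterlim_Rle U (fun _ => 0) (W x)).
    - apply Hall; intros m; apply HW.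
    - apply filterlim_const.
    - apply HlimW. }
  assert (P_npos : forall x, x <= 0 -> P x = 0).
  { intros x Hx; apply Rle_antisym; [|apply P_ge_0].
    apply (filterlim_Rle U (W x) (fun _ => 0)).
    - apply Hall; intros m; unfold W; rewrite cell_npos by (auto; apply step_pos).
      right; reflexivity.
    - apply HlimW.
    - apply filterlim_const. }
  exists a, v, P; repeat split; auto.
  (* Grid distances converge to [Rmax y 0 - Rmax x 0]. Replacing this by [y - x] is harmless in the
     lower bound, because [P x = 0] when [x <= 0], and in the upper bound, because the positive part
     is 1-Lipschitz. *)
  - apply Rle_trans with ((Rmax y 0 - Rmax x 0) * root N (P x)).
    { destruct (Rle_dec x 0) as [Hx|Hx].
      - rewrite P_npos, root_npos by lra; lra.
      - rewrite !Rmax_left; lra. }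
    apply (filterlim_Rle U (fun m => (X y m - X x m) * root N (W x m))
      (fun m => V x m - V y m)).
    + apply Hall; intros m; apply euler_v_increment; [apply step_pos|].
      apply cell_le; [apply step_pos|exact H].
    + apply (filterlim_Rmult U); [apply (filterlim_Rminus U); auto|].
      apply (filterlim_continuous U); [apply continuous_root, N_ge_1|auto].
    + apply (filterlim_Rminus U); auto.
  - apply Rle_trans with ((Rmax y 0 - Rmax x 0) * root N (P y)).
    2: { apply Rmult_le_compat_r; [apply root_ge_0|].
         unfold Rmax; destruct (Rle_dec x 0), (Rle_dec y 0); lra. }
    apply (filterlim_Rle U (fun m => V x m - V y m)
      (fun m => (X y m - X x m) * root N (W y m))).
    + apply Hall; intros m; apply euler_v_increment; [apply step_pos|].
      apply cell_le; [apply step_pos|exact H].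
    + apply (filterlim_Rminus U); auto.
    + apply (filterlim_Rmult U); [apply (filterlim_Rminus U); auto|].
      apply (filterlim_continuous U); [apply continuous_root, N_ge_1|auto].
  - intros x eps Heps.
    destruct (proj1 (filterlim_locally _ _) (g_cont (v x)) (mkposreal eps Heps))
      as [d Hd].
    (* A bound, uniform in [m], for the slopes up to [x + 1]; it covers [y] because [delta <= 1].
       The radius is chosen so that moving by [2 * delta] changes [v] by less than [d / 2]. *)
    set (C := root N (Rmax (x + 1) 0 ^ N * G)).
    assert (HC : 0 <= C) by apply root_ge_0.
    assert (Hd0 := cond_pos d).
    set (delta := Rmin 1 (d / (4 * (C + 1)))).
    assert (Hdelta : 0 < delta).
    { apply Rmin_glb_lt; [lra|]; apply Rdiv_lt_0_compat; lra. }
    assert (HCd : C * (2 * delta) < d / 2).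
    { assert (delta <= d / (4 * (C + 1))) by apply Rmin_r.
      assert (d / (4 * (C + 1)) * (4 * (C + 1)) = d) by (field; lra).
      nra. }
    exists delta; split; [exact Hdelta|]; intros y Hy.
    assert (Hy1 : x <= x + 1 /\ y <= x + 1).
    { apply Rabs_def2 in Hy; assert (delta <= 1) by apply Rmin_l; lra. }
    apply (filterlim_Rle U
      (fun m => Rabs (W y m - W x m - (X y m ^ N - X x m ^ N) * g (v x)))
      (fun m => eps * Rabs (X y m ^ N - X x m ^ N))).
    (* The other [d / 2] comes from convergence at [x], valid for [U]-many [m]. So [euler_v] is
       within [d] of [v x] at all indices between the two cells, and [g] is within [eps]. *)
    + assert (H1 : U (fun m => Rabs (V x m - v x) < d / 2)).
      { assert (Hd2 : 0 < d / 2) by lra.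
        exact (proj1 (filterlim_locally _ _) (HlimV x) (mkposreal _ Hd2)). }
      generalize (filter_and _ _ H1 (Hev _ (step_lt_eventually delta Hdelta))).
      apply filter_imp; clear H1; intros m [Hm Hstep].
      apply euler_s_approx; [apply step_pos|]; intros k Hk.
      set (i := cell (step m) x) in *; set (j := cell (step m) y) in *.
      assert (Hi : (i <= cell (step m) (x + 1))%nat) by (apply cell_le; [apply step_pos|lra]).
      assert (Hj : (j <= cell (step m) (x + 1))%nat) by (apply cell_le; [apply step_pos|lra]).
      left; apply (Hd (euler_v (step m) (alpha m) k)).
      assert (HL := euler_v_lipschitz (step m) (alpha m) C i k
        (cell (step m) (x + 1)) (step_pos m) Hi ltac:(lia)
        (root_le_compat N _ _ N_ge_1 (proj2 (HW (x + 1) m)))).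
      (* One [delta] accounts for the distance from [x] to [y], the other for rounding to the
         grid. *)
      assert (Hki : Rabs (INR k * step m - INR i * step m) <= 2 * delta).
      { assert (Hcx := cell_spec (step m) x (step_pos m)).
        assert (Hcy := cell_spec (step m) y (step_pos m)).
        fold i in Hcx; fold j in Hcy.
        assert (Hmax : Rabs (Rmax y 0 - Rmax x 0) < delta).
        { apply Rabs_def2 in Hy; apply Rabs_def1;
          unfold Rmax; destruct (Rle_dec x 0), (Rle_dec y 0); lra. }
        apply Rabs_def2 in Hmax; pose proof (step_pos m) as Hs.
        destruct (le_lt_dec i j) as [Hij|Hij].
        - assert (INR i <= INR k <= INR j) by (split; apply le_INR; lia).
          apply Rabs_le; split; nra.
        - assert (INR j <= INR k <= INR i) by (split; apply le_INR; lia).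
          apply Rabs_le; split; nra. }
      assert (HL' : C * Rabs (INR k * step m - INR i * step m) <= C * (2 * delta))
        by (apply Rmult_le_compat_l; lra).
      change (Rabs (euler_v (step m) (alpha m) k - v x) < d).
      replace (euler_v (step m) (alpha m) k - v x)
        with ((euler_v (step m) (alpha m) k - V x m) + (V x m - v x)) by ring.
      apply Rle_lt_trans with (1 := Rabs_triang _ _).
      change (V x m) with (euler_v (step m) (alpha m) i) in *; lra.
    + apply (filterlim_continuous U Rabs); [apply continuity_pt_filterlim, Rcontinuity_abs|].
      apply (filterlim_Rminus U); [apply (filterlim_Rminus U); auto|].
      apply (filterlim_Rmult U); [|apply filterlim_const].
      apply (filterlim_Rminus U); apply (filterlim_continuous U (fun z => z ^ N));
        auto using continuous_pow.
    + apply (filterlim_Rmult U); [apply filterlim_const|].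
      apply (filterlim_continuous U Rabs); [apply continuity_pt_filterlim, Rcontinuity_abs|].
      apply (filterlim_Rminus U); apply (filterlim_continuous U (fun z => z ^ N));
        auto using continuous_pow.
  (* The point [1] lies on every grid, so the shooting condition holds exactly for each [m]. *)
  - assert (HV : forall m, V 1 m = 0).
    { intros m; unfold V; rewrite <- (INR_step m).
      rewrite cell_grid by apply step_pos; apply Halpha. }
    apply Rle_antisym.
    + apply (filterlim_Rle U (V 1) (fun _ => 0)); auto; [|apply filterlim_const].
      apply Hall; intros m; rewrite HV; lra.
    + apply (filterlim_Rle U (fun _ => 0) (V 1)); auto; [|apply filterlim_const].
      apply Hall; intros m; rewrite HV; lra.
  - intros x Hx.
    rewrite <- (Rmax_left x 0) at 1 by lra.
    apply (filterlim_Rle U (fun m => a * (1 - X x m)) (V x)); auto.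
    + apply Hall; intros m.
      destruct (Halpha m) as [[H1 H2] H3].
      assert (Hc : (cell (step m) x <= 2 * S m)%nat).
      { rewrite <- (cell_grid (step m) (2 * S m)) by apply step_pos.
        rewrite INR_step; apply cell_le; [apply step_pos|lra]. }
      pose proof (euler_v_chord (step m) (alpha m) _ _ (step_pos m) Hc (INR_step m)) as H.
      rewrite H3 in H; fold (V x m) in H; fold (X x m) in H.
      assert (X x m <= Rmax x 0) by apply cell_spec, step_pos.
      rewrite Rmax_left in H0 by lra; nra.
    + apply (filterlim_Rmult U); [apply filterlim_const|].
      apply (filterlim_Rminus U); [apply filterlim_const|auto].
Qed.

(** * Regularity, positivity and strict concavity of the limit *)

Lemma derivable_deriv_on01 (u u' : R -> R) :
  (forall x, 0 <= x <= 1 -> derivable_pt_lim u x (u' x)) -> deriv_on01 u u'.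
Proof.
  intros H x Hx eps Heps; destruct (H x Hx eps Heps) as [delta Hd].
  exists delta; split; [apply cond_pos|]; intros y _ Hyx Hy.
  specialize (Hd (y - x)); replace (x + (y - x)) with y in Hd by ring.
  apply Hd; [lra|exact Hy].
Qed.

Lemma continuous_cont_on01 (u : R -> R) :
  (forall x, 0 <= x <= 1 -> continuous u x) -> cont_on01 u.
Proof.
  intros H x Hx eps Heps.
  destruct (proj1 (filterlim_locally _ _) (H x Hx) (mkposreal eps Heps)) as [d Hd].
  exists d; split; [apply cond_pos|]; intros y _ Hy; exact (Hd y Hy).
Qed.

Lemma continuous_pos_part_pow (x : R) : continuous (fun y => Rmax y 0 ^ N) x.
Proof.
  apply (continuous_comp (fun y => Rmax y 0) (fun z => z ^ N));
    [|apply continuous_pow].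
  apply filterlim_locally; intros eps; exists eps; intros y Hy.
  apply Rabs_def2 in Hy; unfold minus, plus, opp in Hy; simpl in Hy.
  apply Rabs_def1; unfold minus, plus, opp; simpl;
    unfold Rmax; destruct (Rle_dec x 0), (Rle_dec y 0); lra.
Qed.

(** Away from [0] everything follows from the chain rule for [p = root N (P)]. The delicate point is
    [x = 0], where [P] vanishes; there the quotient [P x / x ^ N] has the positive limit [g (v 0)],
    and [p'] is expressed through it. *)
Lemma radial_solution : exists v p p' : R -> R,
  deriv_on01 v (fun x => - p x) /\ deriv_on01 p p' /\ cont_on01 p' /\
  (forall r, 0 < r < 1 ->
     derivable_pt_lim (fun t => p t ^ N) r (INR N * r ^ (N - 1) * g (v r))) /\
  p 0 = 0 /\ v 1 = 0 /\ (forall r, 0 < r < 1 -> 0 < v r) /\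
  strictly_concave_01 v.
Proof.
  destruct euler_limit as (a & v & P & Ha & HA & HB & P_ge_0 & P_npos & Hv1 & Hv).
  set (p := fun x => root N (P x)).
  assert (P_cont : forall x, continuous P x).
  { intros x; apply filterlim_locally; intros eps.
    destruct (HB x 1 Rlt_0_1) as [d [Hd H]].
    (* Tolerance [1] in [HB] gives a bound of [c] times the variation of [x ^ N] on the increment of
       [P]. *)
    set (c := g (v x) + 1).
    assert (Hc : 0 < c) by (pose proof (g_ge_0 (v x)); unfold c; lra).
    assert (He : 0 < eps / c) by (apply Rdiv_lt_0_compat; [apply cond_pos|exact Hc]).
    destruct (proj1 (filterlim_locally _ _) (continuous_pos_part_pow x)
      (mkposreal _ He)) as [d' Hd'].
    assert (Hdd : 0 < Rmin d d') by (apply Rmin_glb_lt; [exact Hd|apply cond_pos]).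
    exists (mkposreal _ Hdd); intros y Hy.
    change (Rabs (y - x) < Rmin d d') in Hy.
    assert (H1 := H y (Rlt_le_trans _ _ _ Hy (Rmin_l _ _))).
    assert (H2 : Rabs (Rmax y 0 ^ N - Rmax x 0 ^ N) < eps / c)
      by exact (Hd' y (Rlt_le_trans _ _ _ Hy (Rmin_r _ _))).
    change (Rabs (P y - P x) < eps).
    set (e := Rmax y 0 ^ N - Rmax x 0 ^ N) in *.
    replace (P y - P x) with ((P y - P x - e * g (v x)) + e * g (v x)) by ring.
    apply Rle_lt_trans with (1 := Rabs_triang _ _).
    rewrite Rabs_mult, (Rabs_pos_eq (g (v x))) by apply g_ge_0.
    apply Rle_lt_trans with (Rabs e * c); [unfold c; lra|].
    apply Rlt_le_trans with (eps / c * c);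
      [apply Rmult_lt_compat_r; assumption|right; field; lra]. }
  assert (p_cont : forall x, continuous p x).
  { intros x; apply (continuous_comp P (root N)); [apply P_cont|].
    apply continuous_root, N_ge_1. }
  (* By [HA] the difference quotient lies between [- p x] and [- p (x + h)], and [p] is
     continuous. *)
  assert (v_deriv : forall x, derivable_pt_lim v x (- p x)).
  { intros x eps Heps.
    destruct (proj1 (filterlim_locally _ _) (p_cont x) (mkposreal eps Heps)) as [d Hd].
    exists d; intros h Hh0 Hh.
    assert (Hp : Rabs (p (x + h) - p x) < eps).
    { apply (Hd (x + h)); change (Rabs (x + h - x) < d).
      replace (x + h - x) with h by ring; exact Hh. }
    apply Rabs_def2 in Hp.
    assert (Hq : (v (x + h) - v x) / h * h = v (x + h) - v x) by (field; exact Hh0).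
    set (q := (v (x + h) - v x) / h) in *.
    destruct (Rle_dec 0 h) as [H|H].
    - destruct (HA x (x + h)) as [H1 H2]; [lra|].
      replace (x + h - x) with h in H1, H2 by ring.
      fold (p x) in H1; fold (p (x + h)) in H2; apply Rabs_def1; nra.
    - destruct (HA (x + h) x) as [H1 H2]; [lra|].
      replace (x - (x + h)) with (- h) in H1, H2 by ring.
      fold (p (x + h)) in H1; fold (p x) in H2; apply Rabs_def1; nra. }
  assert (v_cont : forall x, continuous v x).
  { intros x; apply (@ex_derive_continuous R_AbsRing R_NormedModule).
    eexists; apply is_derive_Reals, v_deriv. }
  assert (P_deriv : forall x, 0 < x ->
    derivable_pt_lim P x (INR N * x ^ (N - 1) * g (v x))).
  { intros x Hx eps Heps.
    set (D := INR N * x ^ (N - 1)).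
    assert (HD : 0 <= D) by (apply Rmult_le_pos; [apply pos_INR|apply pow_le; lra]).
    pose proof (g_ge_0 (v x)) as Hg0.
    (* With [q] the difference quotient of [x ^ N], that of [P] is within [e1 * Rabs q] of
       [q * g (v x)], where [Rabs q <= D + 1], and [q] is within [e2] of [D]. Each error contributes
       at most [eps / 2]. The radius is also at most [x], so that [x + h] stays positive and the
       positive parts disappear. *)
    set (e1 := eps / (2 * (D + 1))).
    assert (He1 : 0 < e1) by (apply Rdiv_lt_0_compat; lra).
    set (e2 := Rmin 1 (eps / (2 * (g (v x) + 1)))).
    assert (He2 : 0 < e2)
      by (apply Rmin_glb_lt; [lra|apply Rdiv_lt_0_compat; lra]).
    destruct (HB x e1 He1) as [d1 [Hd1 H1]].
    destruct (derivable_pt_lim_pow x N e2 He2) as [d2 H2].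
    assert (Hd : 0 < Rmin x (Rmin d1 d2))
      by (repeat apply Rmin_glb_lt; auto; apply cond_pos).
    exists (mkposreal _ Hd); intros h Hh0 Hh; simpl in Hh.
    assert (Hhx : Rabs h < x) by (eapply Rlt_le_trans; [exact Hh|apply Rmin_l]).
    assert (Hh12 : Rabs h < Rmin d1 d2)
      by (eapply Rlt_le_trans; [exact Hh|apply Rmin_r]).
    specialize (H1 (x + h)); replace (x + h - x) with h in H1 by ring.
    specialize (H1 (Rlt_le_trans _ _ _ Hh12 (Rmin_l _ _))).
    specialize (H2 h Hh0 (Rlt_le_trans _ _ _ Hh12 (Rmin_r _ _))).
    replace (Nat.pred N) with (N - 1)%nat in H2 by lia; fold D in H2.
    apply Rabs_def2 in Hhx.
    rewrite !Rmax_left in H1 by lra.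
    set (q := ((x + h) ^ N - x ^ N) / h) in *.
    replace ((x + h) ^ N - x ^ N) with (q * h) in H1 by (unfold q; field; exact Hh0).
    assert (H3 : Rabs ((P (x + h) - P x) / h - q * g (v x)) <= e1 * Rabs q).
    { replace ((P (x + h) - P x) / h - q * g (v x))
        with ((P (x + h) - P x - q * h * g (v x)) / h) by (field; exact Hh0).
      unfold Rdiv; rewrite Rabs_mult, Rabs_inv.
      rewrite Rabs_mult in H1.
      assert (Hah : 0 < Rabs h) by (apply Rabs_pos_lt, Hh0).
      apply Rmult_le_reg_r with (Rabs h); [exact Hah|].
      rewrite Rmult_assoc, Rinv_l by lra; lra. }
    assert (Hq : Rabs q <= D + 1).
    { assert (e2 <= 1) by apply Rmin_l.
      apply Rabs_def2 in H2; apply Rabs_le; lra. }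
    replace ((P (x + h) - P x) / h - D * g (v x))
      with (((P (x + h) - P x) / h - q * g (v x)) + (q - D) * g (v x)) by ring.
    apply Rle_lt_trans with (1 := Rabs_triang _ _).
    rewrite Rabs_mult, (Rabs_pos_eq (g (v x))) by lra.
    assert (He1D : e1 * Rabs q <= eps / 2).
    { apply Rle_trans with (e1 * (D + 1)); [apply Rmult_le_compat_l; lra|].
      right; unfold e1; field; lra. }
    assert (Hlast : Rabs (q - D) * g (v x) < eps / 2); [|lra].
    apply Rle_lt_trans with (e2 * g (v x)); [apply Rmult_le_compat_r; lra|].
    apply Rlt_le_trans with (e2 * (g (v x) + 1)); [apply Rmult_lt_compat_l; lra|].
    apply Rle_trans with (eps / (2 * (g (v x) + 1)) * (g (v x) + 1)).
    - apply Rmult_le_compat_r; [lra|apply Rmin_r].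
    - right; field; lra. }
  assert (v_pos : forall x, 0 <= x < 1 -> 0 < v x).
  { intros x Hx; apply Rlt_le_trans with (2 := Hv x ltac:(lra)).
    apply Rmult_lt_0_compat; lra. }
  assert (P_incr : forall x y, 0 < x < y -> y <= 1 -> P x < P y).
  { intros x y Hxy Hy.
    destruct (MVT_cor2 P (fun x => INR N * x ^ (N - 1) * g (v x)) x y)
      as [c [Hc1 Hc2]]; [lra| |].
    - intros c Hc; apply P_deriv; lra.
    - assert (0 < INR N * c ^ (N - 1) * g (v c) * (y - x)); [|lra].
      repeat apply Rmult_lt_0_compat; [apply lt_0_INR; lia|apply pow_lt; lra| |lra].
      apply g_pos, v_pos; lra. }
  assert (P_pos : forall x, 0 < x <= 1 -> 0 < P x).
  { intros x Hx; apply Rle_lt_trans with (P (x / 2)); [apply P_ge_0|].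
    apply P_incr; lra. }
  (* [Q x = (p x / x) ^ N] for [x > 0], continued to [x <= 0] by its limit at [0]. *)
  set (Q := fun x => if Rle_dec x 0 then g (v 0) else P x / x ^ N).
  assert (Q_0 : Q 0 = g (v 0)) by (unfold Q; destruct (Rle_dec 0 0); lra).
  assert (Q_eq : forall x, 0 < x -> Q x = P x / x ^ N)
    by (intros x Hx; unfold Q; destruct (Rle_dec x 0); lra).
  assert (Q_cont : forall x, 0 <= x -> continuous Q x).
  { intros x Hx; destruct (Rle_lt_or_eq_dec 0 x Hx) as [Hx0|<-].
    - apply continuous_ext_loc with (fun y => mult (P y) (/ y ^ N)).
      + exists (mkposreal x Hx0); intros y Hy.
        apply Rabs_def2 in Hy; unfold minus, plus, opp in Hy; simpl in Hy.
        symmetry; apply Q_eq; lra.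
      + apply (continuous_mult (K := R_AbsRing)); [apply P_cont|].
        apply (continuous_comp (fun y => y ^ N) Rinv); [apply continuous_pow|].
        apply continuous_Rinv, pow_nonzero; lra.
    - apply filterlim_locally; intros eps.
      assert (Heps2 : 0 < eps / 2) by (pose proof (cond_pos eps); lra).
      (* At [x = 0] the estimate [HB] bounds [P y - y ^ N * g (v 0)] by [eps / 2 * y ^ N]; dividing
         by [y ^ N] gives continuity of [Q]. *)
      destruct (HB 0 (eps / 2) Heps2) as [d [Hd H]].
      exists (mkposreal d Hd); intros y Hy.
      change (Rabs (y - 0) < d) in Hy.
      change (Rabs (Q y - Q 0) < eps); rewrite Q_0.
      unfold Q; destruct (Rle_dec y 0) as [Hy0|Hy0].
      + rewrite Rminus_diag, Rabs_R0; apply cond_pos.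
      + specialize (H y Hy).
        rewrite (Rmax_left y), (Rmax_left 0), (pow_i N), (P_npos 0), !Rminus_0_r in H by (lia || lra).
        assert (HyN : 0 < y ^ N) by (apply pow_lt; lra).
        replace (P y / y ^ N - g (v 0)) with ((P y - y ^ N * g (v 0)) / y ^ N)
          by (field; lra).
        unfold Rdiv; rewrite Rabs_mult, Rabs_inv, (Rabs_pos_eq (y ^ N)) by lra.
        rewrite (Rabs_pos_eq (y ^ N)) in H by lra.
        apply Rle_lt_trans with (eps / 2); [|lra].
        apply Rmult_le_reg_r with (y ^ N); [exact HyN|].
        rewrite Rmult_assoc, Rinv_l by lra; lra. }
  assert (Q_pos : forall x, 0 <= x <= 1 -> 0 < Q x).
  { intros x Hx; destruct (Rle_lt_or_eq_dec 0 x (proj1 Hx)) as [Hx0|<-].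
    - rewrite Q_eq by exact Hx0; apply Rdiv_lt_0_compat; [apply P_pos; lra|].
      apply pow_lt, Hx0.
    - rewrite Q_0; apply g_pos, v_pos; lra. }
  assert (p_0 : p 0 = 0) by (unfold p; rewrite P_npos, root_npos; lra).
  (* For [x > 0] the chain rule gives [p' = x ^ (N - 1) * g (v) * p / P]. Rewritten through [Q],
     this formula is continuous on [[0, 1]], because [Q] is continuous and positive there. *)
  exists v, p, (fun x => g (v x) * (root N (Q x) / Q x)); repeat split; auto.
  - apply derivable_deriv_on01; auto.
  - intros x Hx eps Heps; destruct (Rle_lt_or_eq_dec 0 x (proj1 Hx)) as [Hx0|<-].
    + assert (Hd : derivable_pt_lim p x (g (v x) * (root N (Q x) / Q x))).
      { apply is_derive_Reals.
        replace (g (v x) * (root N (Q x) / Q x))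
          with (scal (INR N * x ^ (N - 1) * g (v x)) (root N (P x) / (INR N * P x))).
        - apply (is_derive_comp (root N) P); [|apply is_derive_Reals, P_deriv, Hx0].
          apply is_derive_root, P_pos; lra.
        - rewrite Q_eq, root_div_pow by (auto; lra).
          unfold scal; simpl; unfold mult; simpl.
          replace (x ^ N) with (x * x ^ (N - 1))
            by (destruct N; [lia|simpl; now rewrite Nat.sub_0_r]).
          field; repeat split; try apply pow_nonzero; try lra.
          + apply Rgt_not_eq, P_pos; lra.
          + apply not_0_INR; lia. }
      destruct (Hd eps Heps) as [d H]; exists d; split; [apply cond_pos|].
      intros y _ Hyx Hy; specialize (H (y - x)).
      replace (x + (y - x)) with y in H by ring; apply H; [lra|exact Hy].
    (* The difference quotient of [p] at [0] is [p y / y = root N (Q y)], so its limit is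
       [root N (Q 0)]. *)
    + assert (Hc : continuous (fun x => root N (Q x)) 0).
      { apply (continuous_comp Q (root N)); [apply Q_cont; lra|].
        apply continuous_root, N_ge_1. }
      destruct (proj1 (filterlim_locally _ _) Hc (mkposreal eps Heps)) as [d Hd].
      exists d; split; [apply cond_pos|]; intros y Hy Hy0 Hyd.
      specialize (Hd y Hyd).
      change (Rabs (root N (Q y) - root N (Q 0)) < eps) in Hd.
      rewrite Q_eq, root_div_pow in Hd by (auto; lra).
      rewrite p_0, !Rminus_0_r, <- Q_0.
      replace (Q 0 * (root N (Q 0) / Q 0)) with (root N (Q 0)); [exact Hd|].
      field; apply Rgt_not_eq, Q_pos; lra.
  - apply continuous_cont_on01; intros x Hx.
    apply (continuous_mult (K := R_AbsRing)).
    + apply (continuous_comp v g); auto.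
    + apply (continuous_mult (K := R_AbsRing)).
      * apply (continuous_comp Q (root N)); [apply Q_cont; lra|].
        apply continuous_root, N_ge_1.
      * apply (continuous_comp Q Rinv); [apply Q_cont; lra|].
        apply continuous_Rinv, Rgt_not_eq, Q_pos, Hx.
  - intros r Hr; apply is_derive_Reals.
    apply is_derive_ext with P; [|apply is_derive_Reals, P_deriv; lra].
    intros t; symmetry; apply root_pow; auto.
  - intros r Hr; apply v_pos; lra.
  - assert (Hstrict : forall x y t, 0 < x -> x < y -> y < 1 -> 0 < t < 1 ->
      t * v x + (1 - t) * v y < v (t * x + (1 - t) * y)).
    { intros x y t Hx Hxy Hy Ht.
      set (z := t * x + (1 - t) * y).
      assert (Hz : x < z < y) by (unfold z; nra).
      (* [HA] alone compares slopes weakly. Splitting [[z, y]] at its midpoint and using that [P]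
         increases strictly makes the mean descent on [[z, y]] exceed [root N (P z)], which bounds
         that on [[x, z]]. *)
      set (m := (z + y) / 2).
      assert (Hm : z < m < y) by (unfold m; lra).
      destruct (HA x z) as [_ H1]; [lra|].
      destruct (HA z m) as [H2 _]; [lra|].
      destruct (HA m y) as [H3 _]; [lra|].
      assert (Hp : root N (P z) < root N (P m)).
      { apply root_lt_compat; [exact N_ge_1|]; split; [apply P_ge_0|].
        apply P_incr; lra. }
      set (pz := root N (P z)) in *; set (pm := root N (P m)) in *.
      assert (H4 : (y - m) * pz < (y - m) * pm) by (apply Rmult_lt_compat_l; lra).
      assert (H5 : (y - z) * pz < v z - v y) by lra.
      replace (z - x) with ((1 - t) * (y - x)) in H1 by (unfold z; ring).
      replace (y - z) with (t * (y - x)) in H5 by (unfold z; ring).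
      assert (t * (v x - v z) <= t * ((1 - t) * (y - x) * pz))
        by (apply Rmult_le_compat_l; lra).
      assert ((1 - t) * (t * (y - x) * pz) < (1 - t) * (v z - v y))
        by (apply Rmult_lt_compat_l; lra).
      lra. }
    intros x y t Hx Hy Hxy Ht; apply Rlt_gt.
    destruct (Rtotal_order x y) as [H|[H|H]]; [apply Hstrict; lra|lra|].
    replace (t * x + (1 - t) * y) with ((1 - t) * y + (1 - (1 - t)) * x) by ring.
    replace (t * v x + (1 - t) * v y) with ((1 - t) * v y + (1 - (1 - t)) * v x) by ring.
    apply Hstrict; lra.
Qed.

End Shooting.

(** * Reduction of both signs to the positive radial problem *)

(* With [sg = 1] and [sg = -1] this produces the negative and the positive solution:
   put [g s = (lambda sg) ^ N f (sg s)] for [s > 0] and [u = - sg v]. *)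
Lemma signed_solution (N : nat) (f : R -> R) (lambda sg : R) :
  (1 <= N)%nat -> cond_f1 N f -> f0_zero N f -> finf_infty N f ->
  0 < lambda -> sg = 1 \/ sg = -1 ->
  exists v : R -> R,
    MO_solution N f lambda (fun x => - sg * v x) /\
    (forall r, 0 < r < 1 -> 0 < v r) /\ strictly_concave_01 v.
Proof.
  intros HN [Hf Hsign] Hf0 Hinf Hl Hsg.
  assert (Hsg2 : sg * sg = 1) by (destruct Hsg; subst; ring).
  assert (HsgN : sg ^ N * sg ^ N = 1) by (rewrite <- Rpow_mult_distr, Hsg2; apply pow1).
  assert (Habs : forall s, Rabs (sg * s) = Rabs s).
  { intros s; destruct Hsg; subst; [now rewrite Rmult_1_l|].
    replace (-1 * s) with (- s) by ring; apply Rabs_Ropp. }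
  assert (HlN : 0 < lambda ^ N) by (apply pow_lt, Hl).
  (* Needed for [g] to vanish on the negative half-line. If [f 0] were nonzero, a small [s] in
     [(0, 1)] would have [f s] within half of [Rabs (f 0)] both of [f 0], by continuity, and of [0],
     by the limit of [f s / s ^ N]. *)
  assert (f_0 : f 0 = 0).
  { apply NNPP; intros H0.
    assert (H0' : 0 < Rabs (f 0) / 2) by (pose proof (Rabs_pos_lt _ H0); lra).
    destruct (Hf0 _ H0') as [d [Hd Hd']].
    destruct (Hf 0 _ H0') as [d' [Hd2 Hd2']].
    set (s := Rmin 1 (Rmin d d') / 2).
    assert (Hs0 : 0 < Rmin 1 (Rmin d d')) by (repeat apply Rmin_glb_lt; lra).
    assert (Hs : 0 < s < 1 /\ s < d /\ s < d').
    { pose proof (Rmin_l 1 (Rmin d d')); pose proof (Rmin_r 1 (Rmin d d')).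
      pose proof (Rmin_l d d'); pose proof (Rmin_r d d'); unfold s; lra. }
    assert (H1 : Rabs (f s / s ^ N) < Rabs (f 0) / 2)
      by (apply Hd'; [lra|rewrite Rabs_pos_eq; lra]).
    assert (H2 : Rabs (f s - f 0) < Rabs (f 0) / 2).
    { apply Hd2'; split; [split; [exact I|lra]|].
      simpl; unfold Rdist; rewrite Rabs_pos_eq; lra. }
    assert (HsN : 0 < s ^ N <= 1).
    { split; [apply pow_lt; lra|]; rewrite <- (pow1 N); apply pow_incr; lra. }
    assert (H3 : Rabs (f s) = Rabs (f s / s ^ N) * s ^ N).
    { rewrite <- (Rabs_pos_eq (s ^ N)) at 2 by lra.
      rewrite <- Rabs_mult; f_equal; field; lra. }
    assert (H4 : Rabs (f s) < Rabs (f 0) / 2) by nra.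
    pose proof (Rabs_triang_inv (f 0) (f s)) as H5.
    rewrite Rabs_minus_sym in H5; lra. }
  set (g := fun s => lambda ^ N * sg ^ N * f (sg * Rmax s 0)).
  (* Since [sg ^ N] is its own inverse, [g] is expressed by the quotient that the conditions at [0]
     and at infinity control. *)
  assert (g_eq : forall s, 0 < s -> g s = lambda ^ N * (f (sg * s) / (sg * s) ^ N) * s ^ N).
  { intros s Hs; unfold g; rewrite Rmax_left, Rpow_mult_distr by lra.
    assert (sg ^ N <> 0) by (intros H; rewrite H in HsgN; lra).
    replace (sg ^ N) with (/ sg ^ N) at 1
      by (apply Rmult_eq_reg_r with (sg ^ N); [rewrite Rinv_l, HsgN|]; auto).
    field; split; [apply pow_nonzero; lra|exact H]. }
  assert (sgs_neq : forall s, 0 < s -> sg * s <> 0) by (intros; destruct Hsg; subst; lra).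
  destruct (radial_solution N g) as (v & p & p' & H1 & H2 & H3 & H4 & H5 & H6 & H7 & H8).
  - exact HN.
  - intros s; apply (continuous_mult (K := R_AbsRing)); [apply continuous_const|].
    apply (continuous_comp (fun s => sg * Rmax s 0) f).
    + apply (continuous_mult (K := R_AbsRing)); [apply continuous_const|].
      apply continuous_ext with (fun y => Rmax y 0 ^ 1); [intros y; apply pow_1|].
      apply continuous_pos_part_pow.
    + apply continuity_pt_filterlim, Hf.
  - intros s Hs; unfold g; rewrite Rmax_right, Rmult_0_r, f_0 by exact Hs; ring.
  - intros s Hs; rewrite g_eq by exact Hs.
    apply Rmult_lt_0_compat; [apply Rmult_lt_0_compat; [exact HlN|]|apply pow_lt, Hs].
    specialize (Hsign (sg * s) (sgs_neq s Hs)).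
    assert (Hne : (sg * s) ^ N <> 0) by (apply pow_nonzero, sgs_neq, Hs).
    replace (f (sg * s) / (sg * s) ^ N)
      with (f (sg * s) * (sg * s) ^ N / ((sg * s) ^ N * (sg * s) ^ N)) by (field; exact Hne).
    apply Rdiv_lt_0_compat; [lra|]; nra.
  - intros eps Heps.
    destruct (Hf0 (eps / lambda ^ N)) as [d [Hd Hd']]; [apply Rdiv_lt_0_compat; lra|].
    exists d; split; [exact Hd|]; intros s Hs.
    rewrite g_eq by lra; apply Rmult_le_compat_r; [apply pow_le; lra|].
    assert (H := Hd' (sg * s) (sgs_neq s ltac:(lra))).
    rewrite Habs, (Rabs_pos_eq s) in H by lra.
    specialize (H ltac:(lra)); apply Rabs_def2 in H.
    apply Rle_trans with (lambda ^ N * (eps / lambda ^ N));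
      [apply Rmult_le_compat_l; lra|right; field; lra].
  - intros M; destruct (Hinf (M / lambda ^ N)) as [K [HK H]].
    exists K; split; [exact HK|]; intros s Hs.
    rewrite g_eq by lra; apply Rmult_le_compat_r; [apply pow_le; lra|].
    assert (H' := H (sg * s)); rewrite Habs, Rabs_pos_eq in H' by lra.
    specialize (H' Hs).
    apply Rle_trans with (lambda ^ N * (M / lambda ^ N));
      [right; field; lra|apply Rmult_le_compat_l; lra].
  - exists v; split; [|split; assumption].
    assert (Hscal : forall c u u', deriv_on01 u u' ->
      (c = 1 \/ c = -1) -> deriv_on01 (fun x => c * u x) (fun x => c * u' x)).
    { intros c u u' Hu Hc x Hx eps Heps; destruct (Hu x Hx eps Heps) as [d [Hd H]].
      exists d; split; [exact Hd|]; intros y Hy Hyx Hyd.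
      replace ((c * u y - c * u x) / (y - x) - c * u' x)
        with (c * ((u y - u x) / (y - x) - u' x)) by (field; lra).
      rewrite Rabs_mult; replace (Rabs c) with 1.
      - rewrite Rmult_1_l; auto.
      - destruct Hc; subst c; [symmetry; apply Rabs_R1|rewrite Rabs_left; lra]. }
    (* From [u = - sg * v] and [v' = - p] one gets [u' = sg * p]. In the equation the factor
       [sg ^ N] of [(u') ^ N] cancels against the one in [g]. *)
    exists (fun x => sg * p x), (fun x => sg * p' x); repeat split.
    + intros x Hx eps Heps.
      replace (sg * p x) with (- sg * - p x) by ring.
      apply (Hscal (- sg) v (fun x => - p x)); auto; destruct Hsg; subst; lra.
    + apply Hscal; auto.
    + intros x Hx eps Heps; destruct (H3 x Hx eps Heps) as [d [Hd H]].
      exists d; split; [exact Hd|]; intros y Hy Hyd.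
      rewrite <- Rmult_minus_distr_l, Habs; auto.
    + intros r Hr; apply is_derive_Reals.
      apply is_derive_ext with (fun t => scal (sg ^ N) (p t ^ N)).
      { intros t; rewrite Rpow_mult_distr; reflexivity. }
      replace (lambda ^ N * INR N * r ^ (N - 1) * f (- (- sg * v r)))
        with (scal (sg ^ N) (INR N * r ^ (N - 1) * g (v r))).
      * apply (is_derive_scal (fun t => p t ^ N)); apply is_derive_Reals, H4, Hr.
      * unfold g; rewrite Rmax_left by (left; apply H7, Hr).
        replace (- (- sg * v r)) with (sg * v r) by ring.
        unfold scal; simpl; unfold mult; simpl.
        transitivity (sg ^ N * sg ^ N * (lambda ^ N * INR N * r ^ (N - 1) * f (sg * v r)));
          [ring|rewrite HsgN; ring].
    + rewrite H5; ring.
    + rewrite H6; ring.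
Qed.

Theorem theorem4p6 (N : nat) (f : R -> R) :
  (1 <= N)%nat ->
  cond_f1 N f -> f0_zero N f -> finf_infty N f ->
  forall lambda : R, 0 < lambda ->
    exists up um : R -> R,
      MO_solution N f lambda up /\
      (forall r, 0 < r < 1 -> up r > 0) /\ strictly_concave_01 up /\
      MO_solution N f lambda um /\
      (forall r, 0 < r < 1 -> um r < 0) /\ strictly_convex_01 um.
Proof.
  intros HN Hf1 Hf0 Hinf lambda Hl.
  destruct (signed_solution N f lambda (-1) HN Hf1 Hf0 Hinf Hl) as [v [Hv [vpos vconc]]];
    [now right|].
  destruct (signed_solution N f lambda 1 HN Hf1 Hf0 Hinf Hl) as [w [Hw [wpos wconc]]];
    [now left|].
  (* The witnesses keep the form [- sg * v] of [signed_solution], so that [Hv] and [Hw] apply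
     verbatim. *)
  exists (fun x => - -1 * v x), (fun x => - (1) * w x); repeat split; auto.
  - intros r Hr; specialize (vpos r Hr); lra.
  - intros x y t Hx Hy Hxy Ht; specialize (vconc x y t Hx Hy Hxy Ht); lra.
  - intros r Hr; specialize (wpos r Hr); lra.
  - intros x y t Hx Hy Hxy Ht; specialize (wconc x y t Hx Hy Hxy Ht); lra.
Qed.
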